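(* Let $\mathbb{A}=\langle\mathcal{A},G,w\rangle$ be a weighted attack/support argumentation graph and let $d\ge 1$ be a real number with $d>\mathrm{indegree}(G)$. Then the direct aggregation semantics is well-defined on $\mathbb{A}$, i.e. the limit $\mathrm{Deg}^{dir}_{\mathbb{A},d}=\lim_{i\to\infty} f_i$ exists, and it equals $(I-\frac1d G)^{-1}w$ (in particular $I-\frac1d G$ is invertible).
   Context: A weighted attack/support argumentation graph (WASA) is a triple $\mathbb{A}=\langle\mathcal{A},G,w\rangle$, where $\mathcal{A}=(a_1,\dots,a_n)$ is a vector of $n\ge1$ pairwise distinct arguments, $G=(g_{ij})$ is an $n\times n$ matrix with entries in $\{-1,0,1\}$ ($g_{ij}=1$ means $a_j$ supports $a_i$, $g_{ij}=-1$ means $a_j$ attacks $a_i$), and $w\in\mathbb{R}^n$ is the vector of initial plausibilities. $\mathrm{indegree}(G)=\max_{i}\sum_{j}|g_{ij}|$ is the maximum number of edges leading into an argument. For a damping factor $d\ge1$, define $f_0=w$ and $f_i=w+\frac1d G f_{i-1}$ for $i\ge1$ (vectors in $\mathbb{R}^n$). The direct aggregation semantics assigns to $\mathbb{A}$ the vector $\mathrm{Deg}^{dir}_{\mathbb{A},d}=\lim_{i\to\infty}f_i=\sum_{i=0}^\infty(\frac1dG)^iw$, whenever it exists. $I$ is the $n\times n$ identity matrix. *)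

(* Defs.v *)
From HB Require Import structures.
From mathcomp Require Import all_boot all_order all_algebra.
From mathcomp Require Import all_classical all_reals all_analysis.

Set Implicit Arguments.
Unset Strict Implicit.
Unset Printing Implicit Defensive.

Import Order.TTheory GRing.Theory Num.Theory.
Import numFieldNormedType.Exports.

Local Open Scope classical_set_scope.
Local Open Scope ring_scope.

(* [wasa_graph A i j = 1] means that argument j supports argument i, and
   [wasa_graph A i j = -1] that argument j attacks argument i, so that the
   edges leading into argument i are the nonzero entries of row i.  The graph
   is an integer matrix; [wasa_mx] below is its image in the reals. *)
Record wasa (R : realType) (T : Type) (n : nat) := Wasa {
  wasa_args : 'I_n -> T ;
  wasa_graph : 'M[int]_n ;
  wasa_weight : 'cV[R]_n ;
  wasa_size_gt0 : (0 < n)%N ;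
  wasa_args_inj : injective wasa_args ;
  wasa_graph_entries : forall i j, wasa_graph i j \in [:: -1; 0; 1]
}.

Definition indegree (n : nat) (G : 'M[int]_n) : nat :=
  (\max_(i < n) \sum_(j < n) `|G i j|)%N.

Definition wasa_mx (R : realType) (T : Type) (n : nat) (A : wasa R T n) :
    'M[R]_n :=
  map_mx intr (wasa_graph A).

Fixpoint direct_iter (R : realType) (T : Type) (n : nat) (A : wasa R T n)
    (d : R) (i : nat) : 'cV[R]_n :=
  if i is k.+1 then
    wasa_weight A + (d^-1 *: wasa_mx A) *m direct_iter A d k
  else wasa_weight A.

Definition direct_well_defined (R : realType) (T : Type) (n : nat)
    (A : wasa R T n) (d : R) : Prop :=
  cvg (direct_iter A d @ \oo).

(* [lim] is total: this is the direct aggregation semantics only when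
   [direct_well_defined A d] holds. *)
Definition Deg_dir (R : realType) (T : Type) (n : nat) (A : wasa R T n)
    (d : R) : 'cV[R]_n :=
  lim (direct_iter A d @ \oo).

Lemma direct_iterE (R : realType) (T : Type) (n : nat) (A : wasa R T n)
    (d : R) (i : nat) :
  direct_iter A d i =
  \sum_(k < i.+1) (d^-1 *: wasa_mx A) ^+ k *m wasa_weight A.
Proof.
elim: i => [|i IH] /=; first by rewrite big_ord1 expr0 mul1mx.
rewrite IH [RHS]big_ord_recl expr0 mul1mx mulmx_sumr; congr (_ + _).
by apply: eq_bigr => k _; rewrite mulmxA /= /bump /= exprS.
Qed.

(* The semantics is also the sum of the series of (d^-1 G)^k w. *)
Lemma Deg_dirE (R : realType) (T : Type) (n : nat) (A : wasa R T n) (d : R) :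
  Deg_dir A d =
  lim ((fun i => \sum_(k < i.+1) (d^-1 *: wasa_mx A) ^+ k *m wasa_weight A)
         @ \oo).
Proof.
by rewrite /Deg_dir; congr (lim (_ @ \oo)); apply/funext => i; exact: direct_iterE.
Qed.

(* Main.v *)
Require Import Defs.
From HB Require Import structures.
From mathcomp Require Import all_boot all_order all_algebra.
From mathcomp Require Import all_classical all_reals all_analysis.

Set Implicit Arguments.
Unset Strict Implicit.
Unset Printing Implicit Defensive.

Import Order.TTheory GRing.Theory Num.Theory.
Import numFieldNormedType.Exports.

Local Open Scope classical_set_scope.
Local Open Scope ring_scope.

(** In the maximum norm, the operator norm of d^-1 G is its maximal absolute
    row sum, which is at most c = indegree(G) / d < 1.  Hence v = (d^-1 G) v
    forces v = 0, so I - d^-1 G is invertible; and if x solves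
    x = w + (d^-1 G) x, then f_i - x = (d^-1 G)^i (f_0 - x) is dominated by the
    geometric sequence c^i |f_0 - x|. *)

Lemma ler_entry_mx_norm (R : realDomainType) (m n : nat) (M : 'M[R]_(m, n)) i j :
  `|M i j| <= mx_norm M.
Proof.
by rewrite mx_normrE; apply/bigmax_geP; right; exists (i, j).
Qed.

(** The norm on matrices is the entrywise maximum, which is not submultiplicative in general, so row
    sums of [M] take the place of its norm. *)
Lemma mx_norm_mulmx_le (R : realType) (m n p : nat) (M : 'M[R]_(m, n))
    (N : 'M[R]_(n, p)) (c : R) : 0 <= c ->
  (forall i, \sum_j `|M i j| <= c) -> `|M *m N| <= c * `|N|.
Proof.
move=> c0 Mc; rewrite [leLHS]/Num.norm /= mx_normrE.
(* The maximum starts from 0, so the bound itself must be nonnegative; without rows, [Mc] would not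
   give this. *)
apply: bigmax_le => [|[i k] _ /=]; first exact: mulr_ge0.
rewrite mxE (le_trans (ler_norm_sum _ _ _))//.
apply: (@le_trans _ _ (\sum_j `|M i j| * `|N|)); last first.
  by rewrite -mulr_suml ler_wpM2r.
by apply: ler_sum => j _; rewrite normrM ler_wpM2l// ler_entry_mx_norm.
Qed.

Lemma unitmx_1sub (R : realType) (n : nat) (M : 'M[R]_n) (c : R) :
  0 <= c < 1 -> (forall i, \sum_j `|M i j| <= c) -> 1%:M - M \in unitmx.
Proof.
(* Row freeness concerns row vectors; transposing first yields a column vector fixed by [M], to
   which the row-sum bound applies. *)
move=> /andP[c0 c1] Mc; rewrite -unitmx_tr -row_free_unit.
apply: inj_row_free => v /(congr1 trmx); rewrite trmx_mul trmxK trmx0.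
rewrite mulmxBl mul1mx => /eqP; rewrite subr_eq0 => /eqP vE.
apply: trmx_inj; rewrite trmx0; apply/eqP; rewrite -normr_eq0.
(* The bound becomes 0 <= (c - 1) |v^T| with c - 1 < 0. *)
have := mx_norm_mulmx_le v^T c0 Mc; rewrite -vE -subr_ge0 -{2}(mul1r `|v^T|).
rewrite -mulrBl nmulr_rge0 ?subr_lt0// => v0.
by rewrite eq_le v0 normr_ge0.
Qed.

Lemma cvg_affine_iter (R : realType) (n : nat) (M : 'M[R]_n) (c : R)
    (w x : 'cV[R]_n) (f : nat -> 'cV[R]_n) :
  0 <= c < 1 -> (forall i, \sum_j `|M i j| <= c) ->
  x = w + M *m x -> (forall k, f k.+1 = w + M *m f k) -> f @ \oo --> x.
Proof.
move=> /andP[c0 c1] Mc xE fS.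
have fx k : `|f k - x| <= geometric `|f 0 - x| c k.
  elim: k => [|k IH]; first by rewrite /= expr0 mulr1.
  (* Subtracting the fixed-point equation cancels [w]. *)
  rewrite fS {1}xE opprD addrACA subrr add0r -mulmxBr.
  rewrite (le_trans (mx_norm_mulmx_le _ c0 Mc))//.
  by rewrite /= exprS mulrCA ler_wpM2l.
have /cvgr0Pnorm_lt gc : geometric `|f 0 - x| c @ \oo --> 0.
  by apply: cvg_geometric; rewrite ger0_norm.
apply/subr_cvg0/cvgr0Pnorm_lt => e /gc; apply: filterS => k.
exact/le_lt_trans/(le_trans (fx k))/ler_norm.
Qed.

Lemma wasa_row_sum_le (R : realType) (T : Type) (n : nat) (A : wasa R T n)
    (d : R) (i : 'I_n) : 0 < d ->
  \sum_j `|(d^-1 *: wasa_mx A) i j| <= (indegree (wasa_graph A))%:R / d.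
Proof.
(* Each absolute value becomes a natural number over [d], so that the comparison with [indegree]
   takes place in [nat]. *)
move=> d0; under eq_bigr => j _.
  rewrite !mxE normrM (gtr0_norm (_ : 0 < d^-1)) ?invr_gt0// -intr_norm -abszE -pmulrn.
  over.
rewrite -mulr_sumr mulrC ler_wpM2r ?invr_ge0 ?(ltW d0)// -natr_sum ler_nat.
exact: (leq_bigmax (F := fun i => \sum_j `|wasa_graph A i j|)%N).
Qed.

Theorem theorem5 (R : realType) (T : Type) (n : nat) (A : wasa R T n) (d : R)
    (d_ge1 : 1 <= d) (d_gt_indegree : (indegree (wasa_graph A))%:R < d) :
  [/\ direct_well_defined A d,
      1%:M - d^-1 *: wasa_mx A \in unitmx
    & Deg_dir A d = invmx (1%:M - d^-1 *: wasa_mx A) *m wasa_weight A].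
Proof.
have d0 : 0 < d by exact: lt_le_trans d_ge1.
have Mc i := wasa_row_sum_le A i d0.
set M := d^-1 *: wasa_mx A in Mc *.
set c := _ / d in Mc.
have c01 : 0 <= c < 1 by rewrite /c divr_ge0 ?(ltW d0)//= ltr_pdivrMr// mul1r.
have Mu := unitmx_1sub c01 Mc.
set x := invmx _ *m _.
have xE : x = wasa_weight A + M *m x.
  apply/eqP; rewrite -subr_eq -{1}(mul1mx x) -mulmxBl /x mulmxA mulmxV//.
  by rewrite mul1mx.
(* The recursion required of the sequence holds by definition of [direct_iter]. *)
have fx : direct_iter A d @ \oo --> x by exact: cvg_affine_iter c01 Mc xE _.
split=> //; first by apply/cvg_ex; exists x.
exact/cvg_lim.
Qed.
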